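(* For an integer $k$, let $N(k)$ denote the number of $W$-orbits of prenilpotent pairs of roots in the $E_{10}$ root system having inner product $k$. Then there is a constant $C>0$ such that $N(k)\ge C k^7$ for all integers $k$.
   Context: The $E_{10}$ Dynkin diagram has ten nodes: nine nodes $v_0,v_1,\dots,v_8$ forming a chain ($v_i$ joined to $v_{i+1}$ for $0\le i\le 7$), and a tenth node $v_9$ joined only to $v_2$. Its generalized Cartan matrix $A$ has $A_{ii}=2$, and for $i\ne j$, $A_{ij}=-1$ if nodes $i,j$ are joined and $A_{ij}=0$ otherwise. The root lattice $\Lambda$ is the free abelian group on the simple roots $\alpha_i$ (one for each node), with the symmetric bilinear form (inner product) $\alpha_i\cdot\alpha_j=A_{ij}$; it has signature $(9,1)$. The Weyl group $W$ is the group of isometries of $\Lambda$ generated by the simple reflections $x\mapsto x-(x\cdot\alpha_i)\alpha_i$. ''Root'' means real root, i.e. a $W$-image of a simple root. A root is positive (resp. negative) if it is a nonnegative (resp. nonpositive) integer combination of simple roots; every root is one or the other. Two roots $\alpha,\beta$ form a prenilpotent pair if some element of $W$ sends both $\alpha$ and $\beta$ to positive roots and some element of $W$ sends both $\alpha$ and $\beta$ to negative roots. Pairs are regarded as unordered, and $W$ acts on pairs by acting on both members simultaneously. The number $N(k)$ is a cardinality and may be infinite, in which case the inequality is regarded as holding. *)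

(* Defs.v *)
From HB Require Import structures.
From mathcomp Require Import all_boot all_order all_algebra.
From mathcomp Require Import boolp classical_sets reals constructive_ereal.
From mathcomp Require Import counting_measure.

Set Implicit Arguments.
Unset Strict Implicit.
Unset Printing Implicit Defensive.

Import Order.TTheory GRing.Theory Num.Theory.
Local Open Scope classical_set_scope.
Local Open Scope ring_scope.

(* Nodes are 'I_10: 0, ..., 8 form the chain and 9 is attached to 2. *)
Definition e10_edge (i j : nat) : bool :=
  ((j == i.+1) && (j <= 8)%N) || ((i == 2%N) && (j == 9%N)).

Definition e10_joined (i j : 'I_10) : bool := e10_edge i j || e10_edge j i.

Definition e10_cartan : 'M[int]_10 :=
  \matrix_(i, j) if i == j then 2 else if e10_joined i j then -1 else 0.

(* A row vector x stands for the sum over i of (x 0 i) alpha_i. *)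
Definition e10_lattice : Type := 'rV[int]_10.

Definition simple_root (i : 'I_10) : e10_lattice := delta_mx 0 i.

Definition inner (x y : e10_lattice) : int := (x *m e10_cartan *m y^T) 0 0.

Definition simple_reflection (i : 'I_10) (x : e10_lattice) : e10_lattice :=
  x - inner x (simple_root i) *: simple_root i.

Inductive weyl : (e10_lattice -> e10_lattice) -> Prop :=
| weyl_id : weyl id
| weyl_refl i : weyl (simple_reflection i)
| weyl_comp f g : weyl f -> weyl g -> weyl (f \o g)
| weyl_inv f g : weyl f -> cancel f g -> cancel g f -> weyl g.

Definition real_root : set e10_lattice :=
  [set x | exists w i, weyl w /\ x = w (simple_root i)].

Definition positive_root : set e10_lattice :=
  [set x | real_root x /\ forall i, 0 <= x 0 i].

Definition negative_root : set e10_lattice :=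
  [set x | real_root x /\ forall i, x 0 i <= 0].

Definition prenilpotent (a b : e10_lattice) : Prop :=
  [/\ real_root a, real_root b,
      exists w, [/\ weyl w, positive_root (w a) & positive_root (w b)]
    & exists w, [/\ weyl w, negative_root (w a) & negative_root (w b)]].

(* The unordered pair of a and b is the set [set a; b]; a = b is allowed,
   and matters only for k = 2. *)
Definition prenilpotent_pairs (k : int) : set (set e10_lattice) :=
  [set P | exists a b, [/\ prenilpotent a b, inner a b = k & P = [set a; b]]].

Definition weyl_orbit (P : set e10_lattice) : set (set e10_lattice) :=
  [set w @` P | w in weyl].

(* [counting] is the cardinality of a finite set and +oo on infinite sets. *)
Definition num_orbits (R : realType) (k : int) : \bar R :=
  counting [set weyl_orbit P | P in prenilpotent_pairs k].

(* Main.v *)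
Require Import Defs.
From mathcomp Require Import all_boot all_order all_algebra.
From mathcomp Require Import boolp classical_sets reals constructive_ereal.
From mathcomp Require Import finmap functions cardinality counting_measure.
From mathcomp Require Import zify ring lra.

Set Implicit Arguments.
Unset Strict Implicit.
Unset Printing Implicit Defensive.
Import Order.TTheory GRing.Theory Num.Theory.
Local Open Scope ring_scope.

(** The lattice is E8 + U, so a pair of norm-2 vectors can be written down by
    hand.  Fix a norm-2 vector [a] of E8 and let [b] run over the vectors
      b = v + x f + y e,   v in E8,  v.a = k,
    where [e] ([delta] below) and [f] are the null vectors of the hyperbolic
    plane.  For given [x] and [v] the condition b.b = 2 can be solved for [y]
    exactly when v.v/2 - 1 is divisible by [x].  There are about k values of
    [x] below a small multiple of k, and for each of them about x^6 classes of
    such [v] modulo [x], as [v] ranges over a 7-dimensional affine lattice and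
    satisfies one quadratic congruence.  This gives a multiple of k^7 pairs.
    It remains to see that all these pairs are prenilpotent, and that only
    boundedly many of them share a Weyl orbit.

    Prenilpotence.  A vector of norm 2 has coefficients of one sign: otherwise
    its positive and negative parts would be supported on proper subdiagrams,
    which are of finite or affine type, and the norm would be at least 4
    ([norm2_signs]).  Induction on the height then shows that every norm-2
    vector is a real root ([norm2_real_root]).  If moreover a.b > 0, one of
    the identity and the reflections in [a] and [b] makes both roots positive,
    and another one makes both negative ([prenilpotent_norm2]).

    Bounded multiplicity.  Let w fix [a] and send [b] to another member b' of
    the family.  Both [delta] and w delta are null vectors orthogonal to [a]
    having small products with b'; since the orthogonal complement of the
    projection of b' away from [a] is positive definite, two such null vectors
    are proportional, so w fixes [delta] ([small_null_unique]).  Then w acts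
    on the definite lattice delta^perp / delta, hence through a finite group,
    and this action determines [v] modulo [x] ([same_type_congr]).

    Counting the solutions.  For seven orthogonal roots of E8 orthogonal to
    [a], the congruence becomes a quadratic equation modulo [x] whose first
    four variables enter as a sum of four squares.  For odd [x] that form has a
    totally isotropic plane, spanned by (a,b,1,0) and (-b,a,0,1) where
    a^2 + b^2 = -1 modulo x ([minus_one_two_squares]).  Along translates of
    this plane the equation is linear, so each translate by a coprime vector
    (n1,n2,0,0) contains x solutions ([quad_zeros]); a positive proportion of
    the pairs (n1,n2) is coprime ([coprime_pairs_count]). *)

(** * Coordinates and the bilinear form *)

Definition vec (s : seq int) : e10_lattice := \row_i s`_i.

Lemma vecE (s : seq int) i : vec s 0 i = s`_i. Proof. by rewrite mxE. Qed.

Lemma vec_surj (x : e10_lattice) : exists x0 x1 x2 x3 x4 x5 x6 x7 x8 x9,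
  x = vec [:: x0; x1; x2; x3; x4; x5; x6; x7; x8; x9].
Proof.
pose c k := x 0 (inord k).
exists (c 0), (c 1), (c 2), (c 3), (c 4), (c 5), (c 6), (c 7), (c 8), (c 9)%N.
apply/rowP => i; rewrite vecE -{1}(inord_val i).
by case: i => -[|[|[|[|[|[|[|[|[|[|//]]]]]]]]]].
Qed.

Lemma inner_vec x0 x1 x2 x3 x4 x5 x6 x7 x8 x9 y0 y1 y2 y3 y4 y5 y6 y7 y8 y9 :
  inner (vec [:: x0; x1; x2; x3; x4; x5; x6; x7; x8; x9])
        (vec [:: y0; y1; y2; y3; y4; y5; y6; y7; y8; y9]) =
  x0 * (2 * y0 - y1) + x1 * (2 * y1 - y0 - y2) + x2 * (2 * y2 - y1 - y3 - y9)
  + x3 * (2 * y3 - y2 - y4) + x4 * (2 * y4 - y3 - y5)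
  + x5 * (2 * y5 - y4 - y6) + x6 * (2 * y6 - y5 - y7)
  + x7 * (2 * y7 - y6 - y8) + x8 * (2 * y8 - y7) + x9 * (2 * y9 - y2).
Proof.
rewrite /inner !mxE.
under eq_bigr => j _ do (rewrite !mxE; under eq_bigr => i _ do rewrite !mxE).
rewrite !big_ord_recl !big_ord0 /=.
ring.
Qed.

Lemma innerDl x y z : inner (x + y) z = inner x z + inner y z.
Proof. by rewrite /inner !mulmxDl mxE. Qed.

Lemma innerZl c x y : inner (c *: x) y = c * inner x y.
Proof. by rewrite /inner -!scalemxAl mxE. Qed.

Lemma innerC x y : inner x y = inner y x.
Proof.
have [? [? [? [? [? [? [? [? [? [? ->]]]]]]]]]] := vec_surj x.
have [? [? [? [? [? [? [? [? [? [? ->]]]]]]]]]] := vec_surj y.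
by rewrite !inner_vec; ring.
Qed.

Lemma innerNl x y : inner (- x) y = - inner x y.
Proof. by rewrite -scaleN1r innerZl mulN1r. Qed.

Lemma innerDr x y z : inner x (y + z) = inner x y + inner x z.
Proof. by rewrite innerC innerDl !(innerC x). Qed.

Lemma innerZr c x y : inner x (c *: y) = c * inner x y.
Proof. by rewrite innerC innerZl innerC. Qed.

Lemma innerNr x y : inner x (- y) = - inner x y.
Proof. by rewrite innerC innerNl innerC. Qed.

Lemma inner_suml n (F : 'I_n -> e10_lattice) y :
  inner (\sum_i F i) y = \sum_i inner (F i) y.
Proof.
elim/big_rec2: _ => [|i u v _ <-]; last exact: innerDl.
by rewrite -(scale0r 0) innerZl mul0r.
Qed.

Definition innerE := (innerDl, innerDr, innerZl, innerZr, innerNl, innerNr).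

Lemma inner_even x : exists m, inner x x = 2 * m.
Proof.
have [x0 [x1 [x2 [x3 [x4 [x5 [x6 [x7 [x8 [x9 ->]]]]]]]]]] := vec_surj x.
rewrite inner_vec.
exists (x0 ^+ 2 + x1 ^+ 2 + x2 ^+ 2 + x3 ^+ 2 + x4 ^+ 2 + x5 ^+ 2 + x6 ^+ 2
  + x7 ^+ 2 + x8 ^+ 2 + x9 ^+ 2 - x0 * x1 - x1 * x2 - x2 * x3 - x3 * x4
  - x4 * x5 - x5 * x6 - x6 * x7 - x7 * x8 - x2 * x9).
ring.
Qed.

(** * The null vector and positivity on orthogonal complements *)

(** The null root of the affine E9 subdiagram on all nodes but 8. *)
Definition delta := vec [:: 2; 4; 6; 5; 4; 3; 2; 1; 0; 3].
(** Together with [delta] this null vector spans the hyperbolic plane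
    orthogonal to the E8 on the nodes 0-6 and 9. *)
Definition delta_dual := vec [:: -2; -4; -6; -5; -4; -3; -2; -1; -1; -3].

Lemma inner_delta w : inner w delta = - w 0 (inord 8).
Proof.
have [? [? [? [? [? [? [? [? [? [? ->]]]]]]]]]] := vec_surj w.
by rewrite inner_vec vecE inordK //=; ring.
Qed.

(** Isolates the linear arithmetic of the next proof from the squares that
    are substituted for these variables. *)
Lemma weighted_sum8 (q a b c d a' b' c' d' : int) :
  60 * q = 30 * a + 10 * b + 30 * c + 30 * d + 10 * a' + 5 * b' + 3 * c'
    + 2 * d' ->
  0 <= a -> 0 <= b -> 0 <= c -> 0 <= d ->
  0 <= a' -> 0 <= b' -> 0 <= c' -> 0 <= d' ->
  0 <= q /\ (q = 0 -> [/\ a = 0, b = 0, c = 0 & d = 0]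
                   /\ [/\ a' = 0, b' = 0, c' = 0 & d' = 0]).
Proof. by move=> *; split; [lia | move=> q0; split; split; lia]. Qed.

(** On delta^perp, i.e. on the E9 lattice, the form is a sum of eight squares,
    found by eliminating the variables from the three ends of the diagram
    towards the branch node; the ninth pivot vanishes. *)
Lemma delta_perp_semidefinite w : inner w delta = 0 ->
  0 <= inner w w /\ (inner w w = 0 -> exists c, w = c *: delta).
Proof.
rewrite inner_delta.
have [x0 [x1 [x2 [x3 [x4 [x5 [x6 [x7 [x8 [x9 ->]]]]]]]]]] := vec_surj w.
rewrite vecE inordK //= => /eqP; rewrite oppr_eq0 => /eqP ->.
rewrite inner_vec; set q := (X in 0 <= X).
have sos : 60 * q =
  30 * (2 * x0 - x1) ^+ 2 + 10 * (3 * x1 - 2 * x2) ^+ 2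
  + 30 * (2 * x9 - x2) ^+ 2 + 30 * (2 * x7 - x6) ^+ 2
  + 10 * (3 * x6 - 2 * x5) ^+ 2 + 5 * (4 * x5 - 3 * x4) ^+ 2
  + 3 * (5 * x4 - 4 * x3) ^+ 2 + 2 * (6 * x3 - 5 * x2) ^+ 2.
  by rewrite /q; ring.
have [q_ge0 q_eq0] := weighted_sum8 sos (sqr_ge0 _) (sqr_ge0 _) (sqr_ge0 _)
  (sqr_ge0 _) (sqr_ge0 _) (sqr_ge0 _) (sqr_ge0 _) (sqr_ge0 _).
split=> // /q_eq0 {sos q_ge0 q_eq0 q}.
have z t : t ^+ 2 = 0 :> int -> t = 0 by move/eqP; rewrite sqrf_eq0 => /eqP.
move=> [[/z h1 /z h2 /z h3 /z h4] [/z h5 /z h6 /z h7 /z h8]].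
exists x7; apply/rowP => i; rewrite [RHS]mxE !vecE.
by case: i => -[|[|[|[|[|[|[|[|[|[|//]]]]]]]]]] _ /=; lia.
Qed.

Lemma scale_inj (m : int) (v w : e10_lattice) :
  m != 0 -> m *: v = m *: w -> v = w.
Proof.
move=> m0 vw; apply/rowP => i; apply: (mulfI m0).
by have := congr1 (fun x : e10_lattice => x 0 i) vw; rewrite !mxE.
Qed.

(** Lorentzian signature in the form used below.  With m = c.delta, nonzero
    because the form is nonnegative on delta^perp, and n = w.delta, the vector
    u = m w - n c lies in delta^perp, so that m^2 w.w = u.u - n^2 c.c is
    nonnegative. *)
Lemma timelike_perp_definite c w : inner c c < 0 -> inner w c = 0 ->
  0 <= inner w w /\ (inner w w = 0 -> w = 0).
Proof.
move=> c_neg wc.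
set m := inner c delta; set n := inner w delta.
have m0 : m != 0.
  by apply/eqP => /delta_perp_semidefinite[]; rewrite leNgt c_neg.
pose u := m *: w - n *: c.
have ue : inner u delta = 0 by rewrite /u !innerE -/m -/n; ring.
have uu : inner u u = m ^+ 2 * inner w w + n ^+ 2 * inner c c.
  by rewrite /u !innerE (innerC c w) wc; ring.
have [u_ge0 u_eq0] := delta_perp_semidefinite ue.
have m2 : 0 < m ^+ 2 by rewrite lt_def sqr_ge0 sqrf_eq0 m0.
have n2 := sqr_ge0 n.
have nc : n ^+ 2 * inner c c <= 0 by rewrite mulr_ge0_le0 // ltW.
have mw : 0 <= m ^+ 2 * inner w w by lia.
split=> [|w_0]; first by rewrite -(pmulr_rge0 _ m2).
move: uu; rewrite w_0 mulr0 add0r => uu.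
have u0 : inner u u = 0 by lia.
have /eqP n0 : n == 0.
  by move: uu; rewrite u0 => /esym/eqP; rewrite mulf_eq0 (lt_eqF c_neg) orbF sqrf_eq0.
have [l ul] := u_eq0 u0.
have lm : l * m == 0.
  rewrite /m innerC -innerZl -ul /u n0 !innerE wc.
  by rewrite mulr0 mul0r subr0.
have l0 : l = 0 by apply/eqP; move: lm; rewrite mulf_eq0 (negPf m0) orbF.
move: ul; rewrite /u l0 n0 !scale0r subr0.
by move=> mw0; apply: (scale_inj m0); rewrite mw0 scaler0.
Qed.

(** The rows of the inverse of the Cartan matrix. *)
Definition coweight (i : nat) : e10_lattice := vec (nth [::] [::
  [:: -4; -9; -14; -12; -10; -8; -6; -4; -2; -7];
  [:: -9; -18; -28; -24; -20; -16; -12; -8; -4; -14];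
  [:: -14; -28; -42; -36; -30; -24; -18; -12; -6; -21];
  [:: -12; -24; -36; -30; -25; -20; -15; -10; -5; -18];
  [:: -10; -20; -30; -25; -20; -16; -12; -8; -4; -15];
  [:: -8; -16; -24; -20; -16; -12; -9; -6; -3; -12];
  [:: -6; -12; -18; -15; -12; -9; -6; -4; -2; -9];
  [:: -4; -8; -12; -10; -8; -6; -4; -2; -1; -6];
  [:: -2; -4; -6; -5; -4; -3; -2; -1; 0; -3];
  [:: -7; -14; -21; -18; -15; -12; -9; -6; -3; -10]] i).

Lemma inner_coweight w (i : 'I_10) : inner w (coweight i) = w 0 i.
Proof.
have [? [? [? [? [? [? [? [? [? [? ->]]]]]]]]]] := vec_surj w.
rewrite vecE; case: i => -[|[|[|[|[|[|[|[|[|[|//]]]]]]]]]] /= ?;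
  by rewrite inner_vec /=; ring.
Qed.

(** Deleting a node other than 8 leaves a diagram of finite type: the
    corresponding coweight has negative norm. *)
Lemma coweight_timelike (i : 'I_10) : i != 8 :> nat ->
  inner (coweight i) (coweight i) < 0.
Proof.
rewrite inner_coweight vecE.
by case: i => -[|[|[|[|[|[|[|[|[|[|//]]]]]]]]]].
Qed.

Lemma vecB (x y : e10_lattice) i : (x - y) 0 i = x 0 i - y 0 i.
Proof. by rewrite !mxE. Qed.
Lemma vecN (x : e10_lattice) i : (- x) 0 i = - x 0 i.
Proof. by rewrite !mxE. Qed.
Lemma vecZ c (x : e10_lattice) i : (c *: x) 0 i = c * x 0 i.
Proof. by rewrite !mxE. Qed.

(** * Norm-2 vectors are real roots *)

Lemma inner_simple_simple (i j : 'I_10) :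
  inner (simple_root i) (simple_root j) = e10_cartan i j.
Proof.
by rewrite /inner /simple_root -rowE mxE (bigD1 j) //= !mxE !eqxx mulr1 big1
  ?addr0 // => l lj; rewrite !mxE (negPf lj) /= mulr0.
Qed.

Lemma inner_simple_self i : inner (simple_root i) (simple_root i) = 2.
Proof. by rewrite inner_simple_simple mxE eqxx. Qed.

Lemma inner_coord x y : inner x y = \sum_i x 0 i * inner (simple_root i) y.
Proof.
rewrite {1}[x]row_sum_delta inner_suml.
by apply: eq_bigr => i _; rewrite innerZl.
Qed.

Lemma inner_coord2 x y :
  inner x y = \sum_i \sum_j x 0 i * y 0 j * e10_cartan i j.
Proof.
rewrite inner_coord; apply: eq_bigr => i _; rewrite innerC inner_coord mulr_sumr.
apply: eq_bigr => j _; rewrite inner_simple_simple mulrA; congr (_ * _).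
by rewrite !mxE eq_sym [e10_joined j i]orbC.
Qed.

Definition pos_part (x : e10_lattice) : e10_lattice := \row_i Num.max (x 0 i) 0.
Definition neg_part x := pos_part (- x).

Lemma partsP (x : e10_lattice) i :
  [/\ 0 <= x 0 i, pos_part x 0 i = x 0 i & neg_part x 0 i = 0] \/
  [/\ x 0 i <= 0, pos_part x 0 i = 0 & neg_part x 0 i = - x 0 i].
Proof.
rewrite !mxE; have [xi|xi] := lerP 0 (x 0 i); [left|right]; split; rewrite ?ltW //.
  by rewrite max_r // oppr_le0.
by rewrite max_l // oppr_ge0 ltW.
Qed.

Lemma pos_part_neg_part x : x = pos_part x - neg_part x.
Proof. by apply/rowP => i; rewrite vecB; case: (partsP x i) => -[_ -> ->]; lia. Qed.

Lemma inner_parts x : inner (pos_part x) (neg_part x) <= 0.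
Proof.
rewrite inner_coord2; apply: sumr_le0 => i _; apply: sumr_le0 => j _.
have : 0 <= pos_part x 0 i by case: (partsP x i) => -[? -> _].
have : 0 <= neg_part x 0 j by case: (partsP x j) => -[? _ ->]; rewrite ?oppr_ge0.
rewrite [e10_cartan i j]mxE; case: eqVneq => [<-|ij].
  by case: (partsP x i) => -[_ -> ->]; rewrite ?mul0r ?mulr0 ?mul0r.
by case: ifP => _; nia.
Qed.

(** The sublattice of a proper subdiagram is the orthogonal complement of a
    coweight, which is timelike, or null if the missing node is 8. *)
Lemma inner_zero_coord (p : e10_lattice) (j : 'I_10) : p 0 j = 0 ->
  0 <= inner p p /\
  (inner p p = 0 -> p = 0 \/ j = 8 :> nat /\ exists c, p = c *: delta).
Proof.
have [j8|j8] := eqVneq (j : nat) 8%N => pj.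
  have pd : inner p delta = 0.
    rewrite inner_delta (_ : inord 8 = j) ?pj ?oppr0 //.
    by apply: val_inj; rewrite /= inordK.
  by have [? h] := delta_perp_semidefinite pd; split=> // /h; right.
have pc : inner p (coweight j) = 0 by rewrite inner_coweight.
by have [? h] := timelike_perp_definite (coweight_timelike j8) pc; split=> // /h; left.
Qed.

(** If the positive part p had norm 0 it would be a multiple of [delta], whose
    only zero coordinate is the one of index 8; the negative part q would then
    have a coordinate there, and 2 p.q <= -2 forces q.q = 0, so that q would be
    a multiple of [delta] too and vanish there. *)
Lemma inner_pos_part_gt0 (x : e10_lattice) i j :
  inner x x = 2 -> 0 < x 0 i -> x 0 j < 0 ->
  0 < inner (pos_part x) (pos_part x).
Proof.
move=> x2 xi xj; set p := pos_part x; set q := neg_part x.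
have [pi qi] : 0 < p 0 i /\ q 0 i = 0.
  by rewrite /p /q; case: (partsP x i) => -[? -> ->]; split=> //; lia.
have [pj qj] : p 0 j = 0 /\ 0 < q 0 j.
  by rewrite /p /q; case: (partsP x j) => -[? -> ->]; split=> //; lia.
have [p_ge0 p_eq0] := inner_zero_coord pj.
have [q_ge0 q_eq0] := inner_zero_coord qi.
rewrite lt_neqAle p_ge0 andbT; apply/eqP => /esym pp.
case: (p_eq0 pp) => [p0|[j8 [c pc]]]; first by rewrite p0 mxE in pi.
have c_gt0 : 0 < c.
  move: pi; rewrite pc vecZ vecE => ci.
  have : 0 <= [:: 2; 4; 6; 5; 4; 3; 2; 1; 0; 3]`_i :> int.
    by case: (i) => -[|[|[|[|[|[|[|[|[|[|//]]]]]]]]]].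
  move: ci; set t := _`_i; nia.
have pq : inner p q = - (c * q 0 j).
  rewrite pc innerZl innerC inner_delta (_ : inord 8 = j); first by lia.
  by apply: val_inj; rewrite /= inordK.
have x2' : inner x x = inner p p + inner q q - 2 * inner p q.
  by rewrite (pos_part_neg_part x) -/p -/q !innerE (innerC q p); ring.
have [m qm] := inner_even q.
have : inner q q = 0 by nia.
move=> /q_eq0[q0|[i8 _]]; first by rewrite q0 mxE in qj.
have ij : i = j by apply: val_inj; rewrite /= i8 j8.
by rewrite ij pj in pi.
Qed.

(** The form is even, so two nonzero parts of positive norm contribute at least
    4 to x.x, and the cross term -2 p.q is nonnegative. *)
Lemma norm2_signs x : inner x x = 2 ->
  (forall i, 0 <= x 0 i) \/ (forall i, x 0 i <= 0).
Proof.
move=> x2.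
have [[i xi]|] := pselect (exists i, 0 < x 0 i); last first.
  by move=> h; right=> i; rewrite leNgt; apply/negP => ?; apply: h; exists i.
have [[j xj]|] := pselect (exists j, x 0 j < 0); last first.
  by move=> h; left=> k; rewrite leNgt; apply/negP => ?; apply: h; exists k.
have p_gt0 := inner_pos_part_gt0 x2 xi xj.
have Nx2 : inner (- x) (- x) = 2 by rewrite !innerE opprK.
have Nxi : 0 < (- x) 0 j by rewrite vecN; lia.
have Nxj : (- x) 0 i < 0 by rewrite vecN; lia.
have := inner_pos_part_gt0 Nx2 Nxi Nxj; rewrite -/(neg_part x) => q_gt0.
have [m pm] := inner_even (pos_part x).
have [n qn] := inner_even (neg_part x).
have pq := inner_parts x.
have : inner x x = inner (pos_part x) (pos_part x)
    + inner (neg_part x) (neg_part x) - 2 * inner (pos_part x) (neg_part x).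
  by rewrite {1 2}(pos_part_neg_part x) !innerE (innerC (neg_part x)); ring.
by lia.
Qed.

Lemma weyl_isometry w : weyl w ->
  (forall x y, inner (w x) (w y) = inner x y)
  /\ (forall c x y, w (c *: x + y) = c *: w x + w y).
Proof.
elim=> {w} [|i|f g _ [fi fl] _ [gi gl]|f g _ [fi fl] fK gK].
- by [].
- split=> [x y|c x y]; rewrite /simple_reflection.
    by rewrite !innerE inner_simple_self (innerC (simple_root i)); ring.
  by rewrite !innerE scalerBr scalerA scalerDl opprD addrACA.
- by split=> [x y|c x y] /=; rewrite ?fi ?gi ?gl ?fl.
- split=> [x y|c x y]; first by rewrite -fi !gK.
  by apply: (can_inj fK); rewrite fl !gK.
Qed.

Lemma weyl_inner w x y : weyl w -> inner (w x) (w y) = inner x y.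
Proof. by move=> /weyl_isometry[]. Qed.

Lemma weyl_linear w c x y : weyl w -> w (c *: x + y) = c *: w x + w y.
Proof. by move=> /weyl_isometry[]. Qed.

Lemma weyl0 w : weyl w -> w 0 = 0.
Proof.
move=> hw; have := weyl_linear 1 0 0 hw; rewrite scaler0 scale1r addr0.
by move/esym/eqP; rewrite -subr_eq0 addrK => /eqP.
Qed.

Lemma weylZ w c x : weyl w -> w (c *: x) = c *: w x.
Proof. by move=> hw; rewrite -[c *: x]addr0 weyl_linear // weyl0 // addr0. Qed.

Lemma weylD w x y : weyl w -> w (x + y) = w x + w y.
Proof. by move=> hw; have := weyl_linear 1 x y hw; rewrite !scale1r. Qed.

Lemma weylN w x : weyl w -> w (- x) = - w x.
Proof. by move=> hw; rewrite -scaleN1r weylZ // scaleN1r. Qed.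

Definition reflection (a x : e10_lattice) := x - inner x a *: a.

Lemma reflectionK a : inner a a = 2 -> involutive (reflection a).
Proof.
move=> a2 x; apply/rowP => j.
by rewrite /reflection !vecB !vecZ !innerE a2; ring.
Qed.

Lemma weyl_has_inverse w : weyl w -> exists v, [/\ weyl v, cancel w v & cancel v w].
Proof.
elim=> {w} [|i|f g _ [f' [wf fK f'K]] _ [g' [wg gK g'K]]|f g wf _ fK gK].
- by exists id; split=> //; exact: weyl_id.
- have rK : involutive (simple_reflection i).
    exact: reflectionK (inner_simple_self i).
  by exists (simple_reflection i); split=> //; exact: weyl_refl.
- exists (g' \o f'); split; [exact: weyl_comp| |] => x /=.
    by rewrite fK gK.
  by rewrite g'K f'K.
- by exists f.
Qed.

Lemma real_root_norm a : real_root a -> inner a a = 2.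
Proof. by move=> [w [i [hw ->]]]; rewrite weyl_inner // inner_simple_self. Qed.

Lemma weyl_reflection a : real_root a -> weyl (reflection a).
Proof.
move=> [w [i [hw ->]]]; have [v [hv wK vK]] := weyl_has_inverse hw.
rewrite (_ : reflection _ = w \o simple_reflection i \o v).
  by apply: weyl_comp => //; apply: weyl_comp => //; exact: weyl_refl.
apply/funext => x /=; rewrite /simple_reflection /reflection.
rewrite (weylD _ _ hw) (weylN _ hw) (weylZ _ _ hw) vK; congr (_ - _ *: _).
by rewrite -{1}(vK x) weyl_inner.
Qed.

Lemma real_rootW w a : weyl w -> real_root a -> real_root (w a).
Proof.
move=> hw [v [i [hv ->]]]; exists (w \o v), i; split=> //; exact: weyl_comp.
Qed.

Lemma real_rootN a : real_root a -> real_root (- a).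
Proof.
move=> ra; rewrite (_ : - a = reflection a a); last first.
  by apply/rowP => j; rewrite /reflection real_root_norm // vecB vecN vecZ; ring.
exact: real_rootW (weyl_reflection ra) ra.
Qed.

Lemma simple_real_root i : real_root (simple_root i).
Proof. by exists id, i; split=> //; exact: weyl_id. Qed.

Lemma simple_coord i j : simple_root i 0 j = (j == i)%:R.
Proof. by rewrite mxE. Qed.

(** Since x.x > 0, some simple root in the support of a positive x has positive
    product with x.  Reflecting in it lowers the height, until the reflected
    vector turns negative, which happens only if x is that simple root. *)
Lemma norm2_real_root x : inner x x = 2 -> real_root x.
Proof.
wlog x_ge0 : x / forall i, 0 <= x 0 i => [wlog_pos|].
  move=> x2; have [|x_le0] := norm2_signs x2; first by move/wlog_pos; exact.
  rewrite -[x]opprK; apply: real_rootN; apply: wlog_pos => [i|].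
    by rewrite vecN oppr_ge0.
  by rewrite !innerE opprK.
have [n] := ubnP (absz (\sum_i x 0 i)).
elim: n x x_ge0 => // n IHn x x_ge0 x_lt x2.
have [i xi ri] : exists2 i, 0 < x 0 i & 0 < inner x (simple_root i).
  apply: contrapT => no_i; suff : inner x x <= 0 by rewrite x2.
  rewrite inner_coord; apply: sumr_le0 => i _.
  have := x_ge0 i; rewrite le_eqVlt => /orP[/eqP <-|xi]; first by rewrite mul0r.
  rewrite pmulr_rle0 // leNgt; apply/negP => xri; apply: no_i; exists i => //.
  by rewrite innerC.
pose y := simple_reflection i x; have hr := weyl_refl i.
have yK : x = simple_reflection i y.
  exact: esym (reflectionK (inner_simple_self i) x).
have y2 : inner y y = 2 by rewrite weyl_inner.
have y_coord j : y 0 j = x 0 j - inner x (simple_root i) * (j == i)%:R.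
  by rewrite vecB vecZ simple_coord.
have [y_ge0|y_le0] := norm2_signs y2.
  rewrite yK; apply: real_rootW => //; apply: IHn => //.
  rewrite -ltnS; apply: leq_trans x_lt; rewrite ltnS.
  have sy : \sum_j y 0 j = \sum_j x 0 j - inner x (simple_root i).
    under eq_bigr do rewrite y_coord.
    rewrite sumrB -mulr_sumr (_ : \sum_j (j == i)%:R = 1) ?mulr1 //.
    by rewrite (bigD1 i) //= eqxx big1 ?addr0 // => j /negPf ->.
  have : 0 <= \sum_j y 0 j by exact: sumr_ge0.
  by lia.
have xE : x = x 0 i *: simple_root i.
  apply/rowP => j; rewrite vecZ simple_coord.
  have [->|ji] := eqVneq j i; first by rewrite mulr1.
  have := y_le0 j; rewrite y_coord (negPf ji) mulr0 subr0 mulr0 => ?.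
  by apply/eqP; rewrite eq_le x_ge0 andbT.
have x1 : x 0 i = 1.
  by move: x2; rewrite xE !innerE inner_simple_self vecZ simple_coord eqxx; nia.
by rewrite xE x1 scale1r; exact: simple_real_root.
Qed.

Lemma norm2_signed x : inner x x = 2 -> positive_root x \/ negative_root x.
Proof.
by move=> x2; have r := norm2_real_root x2; case: (norm2_signs x2) => h;
  [left|right].
Qed.

Lemma positive_rootN x : negative_root x -> positive_root (- x).
Proof.
by move=> [r n]; split=> [|i]; [exact: real_rootN|rewrite vecN oppr_ge0].
Qed.

Lemma negative_rootN x : positive_root x -> negative_root (- x).
Proof.
by move=> [r n]; split=> [|i]; [exact: real_rootN|rewrite vecN oppr_le0].
Qed.

(** * Prenilpotent pairs *)

Lemma prenilpotentN a b : prenilpotent a b -> prenilpotent (- a) (- b).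
Proof.
move=> [ra rb [v [hv va vb]] [w [hw wa wb]]].
split; [exact: real_rootN|exact: real_rootN| |].
- by exists w; rewrite !weylN //; split=> //; exact: positive_rootN.
- by exists v; rewrite !weylN //; split=> //; exact: negative_rootN.
Qed.

Lemma reflection_self a : inner a a = 2 -> reflection a a = - a.
Proof. by move=> a2; apply/rowP => j; rewrite /reflection a2 vecB vecN vecZ; ring. Qed.

(** If b is negative, the reflections in b and in a do the two jobs.  If b is
    positive and neither reflection makes both roots negative, then b - k a
    and a - k b are both positive, which is impossible for k >= 1. *)
Lemma prenilpotent_of_positive a b :
  positive_root a -> inner a a = 2 -> inner b b = 2 ->
  0 < inner a b -> prenilpotent a b.
Proof.
move=> pa a2 b2; set k := inner a b => k0.
have ba : inner b a = k by rewrite innerC.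
have [ra rb] := (norm2_real_root a2, norm2_real_root b2).
have [wa wb] := (weyl_reflection ra, weyl_reflection rb).
have ab_coord j : reflection b a 0 j = a 0 j - k * b 0 j by rewrite vecB vecZ.
have ba_coord j : reflection a b 0 j = b 0 j - k * a 0 j.
  by rewrite vecB vecZ ba.
have rab : real_root (reflection b a) by exact: real_rootW.
have rba : real_root (reflection a b) by exact: real_rootW.
have saa := reflection_self a2; have sbb := reflection_self b2.
case: (norm2_signed b2) => [pb|nb].
- split=> //; first by exists id; split=> //; exact: weyl_id.
  have ab2 : inner (reflection b a) (reflection b a) = 2 by rewrite weyl_inner.
  have ba2 : inner (reflection a b) (reflection a b) = 2 by rewrite weyl_inner.
  case: (norm2_signed ba2) => [[_ pba]|nba]; last first.
    by exists (reflection a); rewrite saa; split=> //; exact: negative_rootN.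
  case: (norm2_signed ab2) => [[_ pab]|nab]; last first.
    by exists (reflection b); rewrite sbb; split=> //; exact: negative_rootN.
  exfalso.
  have ab j : a 0 j = b 0 j /\ (k - 1) * a 0 j = 0.
    have := (pab j, pba j, pa.2 j, pb.2 j); rewrite ab_coord ba_coord.
    case=> [[[h1 h2] h3] h4]; nia.
  have abE : a = b by apply/rowP => j; case: (ab j).
  have k2 : k = 2 by rewrite /k abE.
  have a0 : a = 0 by apply/rowP => j; case: (ab j); rewrite k2 mxE; lia.
  by move: a2; rewrite a0 -(scale0r 0) innerZl mul0r.
- have [_ a_ge0] := pa; have [_ b_le0] := nb.
  split=> //; [exists (reflection b)|exists (reflection a)]; rewrite ?saa ?sbb; split=> //.
  + by split=> // j; rewrite ab_coord; have := (a_ge0 j, b_le0 j) => -[]; nia.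
  + exact: positive_rootN.
  + exact: negative_rootN.
  + by split=> // j; rewrite ba_coord; have := (a_ge0 j, b_le0 j) => -[]; nia.
Qed.

Lemma prenilpotent_norm2 a b : inner a a = 2 -> inner b b = 2 ->
  0 < inner a b -> prenilpotent a b.
Proof.
move=> a2 b2 ab; case: (norm2_signed a2) => [pa|na].
  exact: prenilpotent_of_positive.
rewrite -[a]opprK -[b]opprK; apply: prenilpotentN.
apply: prenilpotent_of_positive; rewrite ?innerE ?opprK //.
exact: positive_rootN.
Qed.

(** * Rigidity of pairs close to a null vector *)

(** Orthogonality to the simple roots other than the one of index 8 means
    orthogonality to all of delta^perp, whose radical is spanned by [delta]. *)
Lemma delta_perp_radical d : inner d delta = 0 ->
  (forall j : 'I_10, j != 8 :> nat -> inner d (simple_root j) = 0) ->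
  exists c, d = c *: delta.
Proof.
move=> dd d0; have [_] := delta_perp_semidefinite dd; apply.
rewrite inner_coord big1 // => j _.
have [j8|j8] := eqVneq (j : nat) 8%N; last by rewrite innerC d0 ?mulr0.
move: dd; rewrite inner_delta (_ : inord 8 = j) => [/eqP|].
  by rewrite oppr_eq0 => /eqP ->; rewrite mul0r.
by apply: val_inj; rewrite /= inordK.
Qed.

Lemma delta_perp_norm2_bound s t : inner s delta = 0 -> inner t delta = 0 ->
  inner s s = 2 -> inner t t = 2 -> -2 <= inner s t <= 2.
Proof.
move=> sd td s2 t2.
have /delta_perp_semidefinite[p _] : inner (s + t) delta = 0 by rewrite innerDl sd td.
have /delta_perp_semidefinite[m _] : inner (s - t) delta = 0.
  by rewrite innerDl innerNl sd td subr0.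
move: p m; rewrite !innerE s2 t2 (innerC t s); set z := inner s t; lia.
Qed.

Lemma inner_dual_delta : inner delta_dual delta = 1.
Proof. by rewrite inner_vec. Qed.

Lemma delta_null : inner delta delta = 0.
Proof. by rewrite inner_vec. Qed.

(** Put e' = w delta, t = delta.e', and let c be the multiple 2 b' - k a of the
    projection of b' away from a; c is timelike.  The combination
    x delta - x' e' is orthogonal to c and has norm - 2 x x' t, so t <= 0.
    Projecting x delta + x' e' away from c gives a vector of nonnegative norm,
    which amounts to t >= - 4 x x' / (k^2 - 4) > -1.  Hence t = 0, so the first
    combination has norm 0 and vanishes.  As [delta] and e' are primitive they
    coincide. *)
Lemma small_null_unique k x x' a b b' w : weyl w -> w a = a -> w b = b' ->
  inner a a = 2 -> inner b b = 2 -> inner a b = k ->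
  inner a delta = 0 -> inner b delta = x -> inner b' delta = x' ->
  0 < x -> 0 < x' -> 4 * (x * x') < k ^+ 2 - 4 ->
  w delta = delta /\ x = x'.
Proof.
move=> hw wa wb a2 b2 ab ad bd b'd x0 x'0 small.
set e' := w delta; set t := inner delta e'; pose D := k ^+ 2 - 4.
have b'2 : inner b' b' = 2 by rewrite -wb weyl_inner.
have ab' : inner a b' = k by rewrite -wb -{1}wa weyl_inner.
have e'e' : inner e' e' = 0 by rewrite weyl_inner // delta_null.
have e'a : inner e' a = 0 by rewrite -{1}wa weyl_inner // innerC.
have e'b' : inner e' b' = x by rewrite -{1}wb weyl_inner // innerC.
have db' : inner delta b' = x' by rewrite innerC.
have da : inner delta a = 0 by rewrite innerC.
pose c := 2 *: b' - k *: a.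
have cc : inner c c = -2 * D.
  by rewrite /c !innerE a2 b'2 (innerC b' a) ab' /D; ring.
have cc0 : inner c c < 0 by rewrite cc /D; lia.
have dc : inner delta c = 2 * x' by rewrite /c !innerE db' da; ring.
have e'c : inner e' c = 2 * x by rewrite /c !innerE e'b' e'a; ring.
clearbody c.
pose u := x *: delta - x' *: e'.
have uc : inner u c = 0 by rewrite /u !innerE dc e'c; ring.
have [u_ge0 u_eq0] := timelike_perp_definite cc0 uc.
have uu : inner u u = - (2 * (x * x') * t).
  by rewrite /u !innerE delta_null e'e' (innerC e' delta) -/t; ring.
(* The coefficient of c is chosen to make z orthogonal to c; clearing the
   denominator D keeps z in the lattice. *)
pose z := D *: (x *: delta + x' *: e') + (2 * (x * x')) *: c.
have zc : inner z c = 0 by rewrite /z !innerE dc e'c cc; ring.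
have [z_ge0 _] := timelike_perp_definite cc0 zc.
have zz : inner z z = 2 * (x * x') * D * (D * t + 4 * (x * x')).
  rewrite /z !innerE delta_null e'e' (innerC e' delta) -/t (innerC c delta).
  by rewrite (innerC c e') dc e'c cc; ring.
have xx : 0 < x * x' by rewrite mulr_gt0.
have D0 : 0 < D by rewrite /D; lia.
have t0 : t = 0.
  apply/eqP; rewrite eq_le; apply/andP; split.
    move: u_ge0; rewrite uu oppr_ge0 pmulr_rle0 //; lia.
  move: z_ge0; rewrite zz pmulr_rge0; last by rewrite mulr_gt0 //; lia.
  move: small; rewrite -/D; move: (x * x') => y; nia.
have u0 : x *: delta = x' *: e'.
  by apply/eqP; rewrite -subr_eq0 -/u; apply/eqP/u_eq0; rewrite uu t0 mulr0 oppr0.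
(* Pairing with vectors of product 1 with delta and with e'. *)
have fx : x = x' * inner e' delta_dual.
  by rewrite -innerZl -u0 innerZl innerC inner_dual_delta mulr1.
have fx' : x' = x * inner delta (w delta_dual).
  rewrite -innerZl u0 innerZl weyl_inner // innerC.
  by rewrite inner_dual_delta mulr1.
have xx' : x = x'.
  have le_mul (y y' p : int) : 0 < y -> 0 < y' -> y = y' * p -> y' <= y.
    move=> y0 y'0 yE; have p0 : 0 < p by rewrite -(pmulr_rgt0 _ y'0) -yE.
    by rewrite yE ler_peMr; lia.
  by apply/eqP; rewrite eq_le (le_mul _ _ _ x'0 x0 fx') (le_mul _ _ _ x0 x'0 fx).
split=> //; apply: (@scale_inj x); first by rewrite gt_eqF.
by rewrite u0 xx'.
Qed.

(** w r and w' r have the same products with delta^perp, hence differ by a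
    multiple of [delta]; and [delta] pairs to x with the common image t. *)
Lemma same_type_congr x (b b' t r : e10_lattice) w w' :
  weyl w -> weyl w' -> w delta = delta -> w' delta = delta ->
  w b = t -> w' b' = t -> inner t delta = x -> inner r delta = 0 ->
  (forall j : 'I_10, j != 8 :> nat ->
    inner (w r) (simple_root j) = inner (w' r) (simple_root j)) ->
  exists c, inner b r - inner b' r = c * x.
Proof.
move=> hw hw' wd w'd wb w'b' td rd same.
have [|j j8|c cE] := @delta_perp_radical (w r - w' r).
- by rewrite innerDl innerNl -{1}wd -{2}w'd !weyl_inner // rd subrr.
- by rewrite innerDl innerNl same // subrr.
exists c; rewrite -(weyl_inner b r hw) -(weyl_inner b' r hw') wb w'b'.
by rewrite -innerNr -innerDr cE innerZr td.
Qed.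

(** * The family of pairs *)

Definition fixed_root := vec [:: 1; 0; 0; 0; 0; 0; 0; 0; 0; 0].
(** Half the sum of [fixed_root] and of the last three vectors of
    [orth_root]: a codeword of the Hamming code that glues the eight orthogonal
    copies of A1 into E8.  It has product 1 with [fixed_root] and 0 with the
    first four vectors of [orth_root], so only the last three variables acquire
    linear terms. *)
Definition glue := vec [:: 1; 1; 1; 1; 0; 0; 0; 0; 0; 1].
Definition orth_root (i : nat) := vec (nth [::] [::
  [:: 0; 0; 0; 0; 0; 1; 0; 0; 0; 0];
  [:: 1; 2; 2; 2; 2; 1; 0; 0; 0; 1];
  [:: 1; 2; 4; 3; 2; 1; 0; 0; 0; 2];
  [:: 2; 4; 6; 5; 4; 3; 2; 0; 0; 3];
  [:: 0; 0; 0; 0; 0; 0; 0; 0; 0; 1];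
  [:: 0; 0; 0; 1; 0; 0; 0; 0; 0; 0];
  [:: 1; 2; 2; 1; 0; 0; 0; 0; 0; 1]] i).

Definition in_glue (i : nat) : int := (3 < i)%N%:R.

Lemma orth_root_orth (i j : 'I_7) :
  inner (orth_root i) (orth_root j) = 2 * (i == j)%:R.
Proof.
case: i j => -[|[|[|[|[|[|[|//]]]]]]] /= ? [[|[|[|[|[|[|[|//]]]]]]] /= ?];
  by rewrite inner_vec.
Qed.

Lemma orth_root_perp (i : 'I_7) :
  [/\ inner (orth_root i) fixed_root = 0, inner (orth_root i) glue = in_glue i,
      inner (orth_root i) delta = 0 & inner (orth_root i) delta_dual = 0].
Proof.
by case: i => -[|[|[|[|[|[|[|//]]]]]]] /= ?; split; rewrite inner_vec.
Qed.

Lemma gram : [/\ inner fixed_root fixed_root = 2, inner glue glue = 2,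
  inner glue fixed_root = 1,
  inner fixed_root delta = 0 & inner glue delta = 0] /\
  [/\ inner fixed_root delta_dual = 0, inner glue delta_dual = 0,
    inner delta_dual delta_dual = 0, inner delta_dual delta = 1
    & inner delta delta = 0].
Proof. by split; split; rewrite inner_vec. Qed.

(** The general solution of b.a = k within the lattice spanned by the glue
    vector, the orthogonal roots and the hyperbolic plane. *)
Definition partner (k x y : int) (m : 'I_7 -> int) : e10_lattice :=
  k *: glue + \sum_i m i *: orth_root i + x *: delta_dual + y *: delta.

Lemma partner_delta k x y m : inner (partner k x y m) delta = x.
Proof.
have [[_ _ _ _ gd] [_ _ _ fd dd]] := gram.
rewrite /partner !innerE inner_suml gd fd dd big1 => [|i _]; first by ring.
by have [_ _ rd _] := orth_root_perp i; rewrite innerZl rd mulr0.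
Qed.

Lemma partner_fixed_root k x y m : inner (partner k x y m) fixed_root = k.
Proof.
have [[_ _ ga ad _] [af _ _ _ _]] := gram.
rewrite /partner !innerE inner_suml ga (innerC delta_dual) af (innerC delta) ad.
rewrite big1 => [|i _]; first by ring.
by have [ra _ _ _] := orth_root_perp i; rewrite innerZl ra mulr0.
Qed.

Lemma partner_orth k x y m (j : 'I_7) :
  inner (partner k x y m) (orth_root j) = 2 * m j + k * in_glue j.
Proof.
have [_ rg rd rf] := orth_root_perp j.
rewrite /partner !innerE inner_suml 3!(innerC _ (orth_root j)) rg rd rf.
rewrite (bigD1 j) //= innerZl orth_root_orth eqxx mulr1 big1 => [|i ij].
  by ring.
by rewrite innerZl orth_root_orth (negPf ij) !mulr0.
Qed.

Lemma partner_norm k x y m : inner (partner k x y m) (partner k x y m) =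
  2 * (k ^+ 2 + \sum_i (m i ^+ 2 + k * (m i * in_glue i)) + x * y).
Proof.
have [[_ gg _ _ gd] [_ gf ff fd dd]] := gram.
set p := partner k x y m.
have pg : inner p glue = 2 * k + \sum_i m i * in_glue i.
  rewrite /p /partner !innerE inner_suml gg !(innerC _ glue) gf gd.
  rewrite -[RHS]addr0 -[RHS]addr0; congr (_ + _ + _ + _); try by ring.
  by apply: eq_bigr => i _; have [_ rg _ _] := orth_root_perp i; rewrite innerZl rg.
have pf : inner p delta_dual = y.
  rewrite /p /partner !innerE inner_suml gf ff (innerC delta) fd.
  rewrite big1 => [|i _]; first by ring.
  by have [_ _ _ rf] := orth_root_perp i; rewrite innerZl rf mulr0.
have ps : inner p (\sum_i m i *: orth_root i) =
    \sum_i (2 * m i ^+ 2 + k * (m i * in_glue i)).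
  rewrite innerC inner_suml; apply: eq_bigr => i _.
  by rewrite innerZl innerC partner_orth; ring.
rewrite {2}/p /partner -/p !innerDr !innerZr pg pf ps partner_delta.
rewrite big_split -mulr_sumr [in RHS]big_split -!mulr_sumr /=; ring.
Qed.

(** * Minus one is a sum of two squares modulo odd numbers *)

(** Pigeonhole in F_p: the squares of 0, ..., (p-1)/2 and the values -1 - j^2
    form two sets of (p+1)/2 elements each. *)
Lemma minus_one_two_squares_prime p : prime p -> odd p ->
  exists a b, (p %| a ^ 2 + b ^ 2 + 1)%N.
Proof.
move=> p_pr p_odd; have p_char := pchar_Fp p_pr.
pose h := p./2; have pE : p = h.*2.+1 by rewrite -[LHS]odd_double_half p_odd.
pose sq (i : 'I_h.+1) : 'F_p := i%:R ^+ 2.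
have sq_inj : injective sq.
  move=> i j /eqP; rewrite eqf_sqr => /orP[] /eqP ij; apply/val_inj => /=.
    have eq_mod (u v : nat) : (u <= v)%N -> (v < p)%N -> v%:R = u%:R :> 'F_p -> u = v.
      move=> uv vp /eqP; rewrite -subr_eq0 -natrB // -(dvdn_pcharf p_char).
      by move=> /dvdnP[[|q]]; nia.
    have ip : (i < p)%N by rewrite pE; have := ltn_ord i; lia.
    have jp : (j < p)%N by rewrite pE; have := ltn_ord j; lia.
    by case: (leqP i j) => [le|/ltnW le]; [apply: eq_mod|apply/esym/eq_mod].
  move/eqP: ij; rewrite -addr_eq0 -natrD -(dvdn_pcharf p_char).
  by case/dvdnP => -[|q]; have := (ltn_ord i, ltn_ord j) => -[]; nia.
have [/existsP[i /existsP[j /eqP ij]]|no_sol] :=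
    boolP [exists i, exists j, sq i == -1 - sq j].
  exists i, j; rewrite (dvdn_pcharf p_char) !natrD !natrX -/(sq i) ij.
  by rewrite -/(sq j) addrNK addNr.
have := max_card (mem ([set sq i | i in 'I_h.+1] :|: [set -1 - sq j | j in 'I_h.+1])).
rewrite cardsU disjoint_setI0 ?cards0.
  rewrite subn0 card_imset // card_imset; last first.
    by move=> i j /addrI/oppr_inj/sq_inj.
  by rewrite card_ord card_Fp // {1}pE; lia.
apply/pred0P => z /=; apply/negP => /andP[/imsetP[i _ ->] /imsetP[j _ ij]].
by case/negP: no_sol; apply/existsP; exists i; apply/existsP; exists j; apply/eqP.
Qed.

(** A Newton step in the variable a, whose derivative 2 a is invertible modulo
    p. *)
Lemma minus_one_two_squares_lift p y a b : prime p -> odd p -> (p %| y)%N ->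
  (y %| a ^ 2 + b ^ 2 + 1)%N -> ~~ (p %| a)%N ->
  exists a', (p * y %| a' ^ 2 + b ^ 2 + 1)%N.
Proof.
move=> p_pr p_odd /dvdnP[z yE] /dvdnP[q qE] pa.
have a2 : coprime (2 * a) p.
  by rewrite coprimeMl coprime2n p_odd coprime_sym prime_coprime.
have a2_gt0 : (0 < 2 * a)%N.
  by rewrite muln_gt0 /= lt0n; apply: contraNneq pa => ->; rewrite dvdn0.
have [[u v] /= uv] := coprimeP _ a2_gt0 a2.
have {}uv : (u * (2 * a) = 1 + v * p)%N by lia.
(* p.-1 plays the part of -1, so that q + 2 a s = 0 modulo p. *)
pose s := (u * q * p.-1)%N.
have p0 := prime_gt0 p_pr.
exists (a + y * s)%N; apply/dvdnP; exists (q * (1 + p.-1 * v) + z * s ^ 2)%N.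
have -> : ((a + y * s) ^ 2 + b ^ 2 + 1 =
           (a ^ 2 + b ^ 2 + 1) + y * (u * (2 * a)) * q * p.-1 + y * y * s ^ 2)%N.
  by rewrite /s; move: p.-1 => p'; clear; ring.
have yy : (y * y = z * p * y)%N by rewrite {1}yE.
rewrite qE uv yy; move: p.-1 (prednK p0) (s ^ 2)%N => p' <- s2; clear; ring.
Qed.

Lemma dvdn_sqr_sum_modn d a b a' b' : a = a' %[mod d] -> b = b' %[mod d] ->
  (d %| a ^ 2 + b ^ 2 + 1)%N = (d %| a' ^ 2 + b' ^ 2 + 1)%N.
Proof.
move=> aa bb; rewrite /dvdn -modnDml -(modnDm (a ^ 2)) -(modnXm _ _ a).
by rewrite -(modnXm _ _ b) aa bb !modnXm modnDm modnDml.
Qed.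

(** Induction on the number of prime factors: a new prime p is added by the
    Chinese remainder theorem, a repeated one by lifting in whichever variable
    is prime to p. *)
Lemma minus_one_two_squares x : odd x -> exists a b, (x %| a ^ 2 + b ^ 2 + 1)%N.
Proof.
have [n] := ubnP x; elim: n x => // n IHn x x_lt x_odd.
have [x1|x1] := leqP x 1; first by exists 0%N, 0%N; case: x x_odd x1 {x_lt} => [|[]].
have p_pr := pdiv_prime x1; set p := pdiv x in p_pr.
have /dvdnP[y xE] := pdiv_dvd x; rewrite -/p in xE.
have := x_odd; rewrite xE oddM => /andP[y_odd p_odd].
have y0 : (0 < y)%N by rewrite lt0n; apply: contraTneq y_odd => ->.
have yx : (y < x)%N by rewrite xE -{1}[y]muln1 ltn_pmul2l // prime_gt1.
have [a [b yab]] := IHn y (leq_trans yx x_lt) y_odd.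
rewrite mulnC; have [py|py] := boolP (p %| y)%N; last first.
  have py' : coprime p y by rewrite prime_coprime.
  have [a1 [b1 pab]] := minus_one_two_squares_prime p_pr p_odd.
  exists (chinese p y a1 a), (chinese p y b1 b); rewrite Gauss_dvd //.
  rewrite (dvdn_sqr_sum_modn (chinese_modl py' _ _) (chinese_modl py' _ _)) pab.
  by rewrite (dvdn_sqr_sum_modn (chinese_modr py' _ _) (chinese_modr py' _ _)).
have [pa|pa] := boolP (p %| a)%N; last first.
  have [a' h] := minus_one_two_squares_lift p_pr p_odd py yab pa.
  by exists a', b.
have pb : ~~ (p %| b)%N.
  apply/negP => pb; have := dvdn_trans py yab.
  rewrite dvdn_addr ?dvdn1; last by rewrite dvdn_add // dvdn_exp.
  by move=> /eqP p1; rewrite p1 in p_pr.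
rewrite (addnC (a ^ 2)%N) in yab.
have [b' h] := minus_one_two_squares_lift p_pr p_odd py yab pb.
by exists b', a.
Qed.

(** * The proportion of coprime pairs *)

(** Telescoping with 1/(d+1)^2 <= 1/d - 1/(d+1). *)
Lemma sum_inv_sqr (R : realFieldType) D :
  \sum_(2 <= d < D.+3) (d%:R ^- 2) <= 3 / 4 - D.+2%:R^-1 :> R.
Proof.
elim: D => [|D IHD].
  by rewrite big_nat1 [leLHS](_ : _ = 1 / 4); [lra | field].
rewrite big_nat_recr //=; apply: le_trans (lerD IHD (lexx _)) _.
set d : R := D.+2%:R; have d0 : 0 < d by rewrite ltr0n.
have -> : D.+3%:R = d + 1 by rewrite /d -natr1.
have d1 : 0 < d + 1 by lra.
rewrite -addrA lerD2l -subr_ge0; clearbody d.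
have -> : - (d + 1)^-1 - (- d^-1 + (d + 1) ^- 2) = (d * (d + 1) ^+ 2)^-1.
  by field; rewrite !gt_eqF.
by rewrite invr_ge0 mulr_ge0 ?sqr_ge0 // ltW.
Qed.

(** Union bound: a pair that is not coprime has a common divisor d >= 2, and
    there are at most (N/d)^2 pairs of multiples of d.  As the sum of 1/d^2
    over d >= 2 is at most 3/4, a quarter of all pairs remains. *)
Lemma coprime_pairs_count N :
  (N ^ 2 <= 4 * \sum_(i < N) \sum_(j < N) coprime i.+1 j.+1)%N.
Proof.
pose dvd2 d i j : nat := ((d %| i) * (d %| j))%N.
have shift F : (\sum_(i < N) F i.+1 = \sum_(1 <= i < N.+1) F i)%N.
  by rewrite big_add1 big_mkord.
have -> : (\sum_(i < N) \sum_(j < N) coprime i.+1 j.+1 =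
    \sum_(1 <= i < N.+1) \sum_(1 <= j < N.+1) coprime i j)%N.
  by rewrite -shift; apply: eq_bigr => i _; rewrite -shift.
set C := (\sum_(1 <= i < _) _)%N.
have NC : (N ^ 2 <= C + \sum_(2 <= d < N.+1) (N %/ d) ^ 2)%N.
  have -> : (\sum_(2 <= d < N.+1) (N %/ d) ^ 2 = \sum_(1 <= i < N.+1)
      \sum_(1 <= j < N.+1) \sum_(2 <= d < N.+1) dvd2 d i j)%N.
    under [RHS]eq_bigr do rewrite exchange_big /=.
    rewrite [RHS]exchange_big /= !big_nat; apply: eq_bigr => d /andP[d2 _].
    rewrite divn_count_dvd -mulnn big_distrl /=; apply: eq_bigr => i _.
    by rewrite big_distrr.
  have -> : (N ^ 2 = \sum_(1 <= i < N.+1) \sum_(1 <= j < N.+1) 1)%N.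
    by rewrite !sum_nat_const_nat subn1 muln1 mulnn.
  rewrite /C -big_split /= !big_nat; apply: leq_sum => i /andP[i0 iN].
  rewrite -big_split /= !big_nat; apply: leq_sum => j /andP[j0 jN].
  have [//|ij] := boolP (coprime i j); rewrite add0n.
  have g0 : (0 < gcdn i j)%N by rewrite gcdn_gt0 i0.
  have gi : (gcdn i j <= i)%N by rewrite dvdn_leq ?dvdn_gcdl.
  rewrite (big_rem (gcdn i j)) /=; last first.
    rewrite mem_index_iota; move: ij; rewrite /coprime; lia.
  by rewrite /dvd2 dvdn_gcdl dvdn_gcdr.
case: (N) NC => [|[|D]] NC; [by []|by move: NC; rewrite big_geq //; lia|].
move: NC; set M := D.+2 => NC.
suff : (4 * \sum_(2 <= d < M.+1) (M %/ d) ^ 2 <= 3 * M ^ 2)%N by lia.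
rewrite -(ler_nat rat) natrM [leRHS]natrM natrX natr_sum.
have le d : (0 < d)%N -> ((M %/ d) ^ 2)%:R <= M%:R ^+ 2 * d%:R ^- 2 :> rat.
  move=> d0; rewrite -exprVn -exprMn natrX lerXn2r ?nnegrE ?ler0n //.
    by rewrite mulr_ge0 ?invr_ge0.
  by rewrite ler_pdivlMr ?ltr0n // -natrM ler_nat leq_trunc_div.
apply: (@le_trans _ _ (4 * \sum_(2 <= d < M.+1) M%:R ^+ 2 * d%:R ^- 2)).
  rewrite ler_pM2l // !big_nat; apply: ler_sum => d /andP[d2 _].
  by apply: le; apply: ltnW.
rewrite -mulr_sumr.
have := sum_inv_sqr rat D; set S := \sum_(2 <= d < _) _.
have : 0 < M%:R^-1 :> rat by rewrite invr_gt0 ltr0n.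
have : 0 <= M%:R ^+ 2 :> rat by exact: sqr_ge0.
move: (M%:R ^+ 2) (M%:R^-1) => u v u0 v0 SE.
have SE' : S <= 3 / 4 by lra.
have := ler_wpM2l u0 SE'; lra.
Qed.

(** * Zeros of the quadratic congruence *)

Lemma dvdz_witness (d m q : int) : m = q * d -> (d %| m)%Z.
Proof. by move=> ->; rewrite dvdz_mull. Qed.

Lemma dvdz_small_eq (x u v : nat) : (u < x)%N -> (v < x)%N ->
  (x%:Z %| u%:Z - v%:Z)%Z -> u = v.
Proof.
move=> ux vx; rewrite -eqz_mod_dvd !modz_nat => /eqP[].
by rewrite !modn_small.
Qed.

Lemma odd_dvdz2 (x : nat) (z : int) : odd x -> (x%:Z %| 2 * z)%Z -> (x%:Z %| z)%Z.
Proof.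
by move=> x_odd; rewrite Gauss_dvdzr // coprimezE /= coprimen2.
Qed.

(** Multiplication by a - b i, whose norm is -1 modulo x, carries (n1,n2) to the
    coefficients of the linear equation below; so coprimality modulo x is
    preserved, with these explicit Bezout coefficients. *)
Lemma bezout_combination (a b n1 n2 c1 c2 x c : int) :
  c1 * n1 + c2 * n2 = 1 -> a ^+ 2 + b ^+ 2 + 1 = c * x ->
  (c1 * a + c2 * b) * (a * n1 + b * n2) + (c2 * a - c1 * b) * (a * n2 - b * n1)
  = c * x - 1.
Proof.
move=> cn <-; transitivity ((c1 * n1 + c2 * n2) * (a ^+ 2 + b ^+ 2)).
  by ring.
by rewrite cn; ring.
Qed.

Lemma bezout_int (m n : nat) : (0 < m)%N -> coprime m n ->
  exists c1 c2 : int, c1 * m%:Z + c2 * n%:Z = 1.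
Proof.
move=> m0 mn; have [[u v] /= uv] := coprimeP _ m0 mn.
exists u%:Z, (- v%:Z); lia.
Qed.

(** One less than half the norm of [partner], the term x y being left out. *)
Definition quad (k : int) (m : 'I_7 -> int) : int :=
  k ^+ 2 - 1 + \sum_i (m i ^+ 2 + k * (m i * in_glue i)).

Lemma quad_seq k m0 m1 m2 m3 m4 m5 m6 :
  quad k (fun i => [:: m0; m1; m2; m3; m4; m5; m6]`_i) =
  k ^+ 2 - 1 + m0 ^+ 2 + m1 ^+ 2 + m2 ^+ 2 + m3 ^+ 2
  + (m4 ^+ 2 + k * m4) + (m5 ^+ 2 + k * m5) + (m6 ^+ 2 + k * m6).
Proof. by rewrite /quad !big_ord_recl big_ord0 /in_glue /=; ring. Qed.

(** The entries stand for (n1 - 1, n2 - 1), for the last three variables, and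
    for the position t on a line of solutions.  Indices below x suffice to make
    residues modulo x distinct, and a bound N independent of x avoids dependent
    types. *)
Definition params (N : nat) : finType := 
  ('I_N * 'I_N * ('I_N * 'I_N * 'I_N) * 'I_N)%type.

Definition coprime_params N (p : params N) :=
  coprime p.1.1.1.+1 p.1.1.2.+1.

(** Let a^2 + b^2 = -1 modulo x.  On the points
      (n1 + s a - r b, n2 + s b + r a, s, r)
    the sum of four squares is n1^2 + n2^2 + A s + B r modulo x, where A + B i
    is 2 (a - b i) (n1 + n2 i).  For coprime n1 and n2 the equation A s + B r = T has a solution, and adding multiples
    t (B, -A) gives x distinct ones.  Reading the third and fourth coordinates
    recovers (s, r), then the first two recover (n1, n2), and at last t. *)
Lemma quad_zeros (x N : nat) (k : int) : odd x -> (N < x)%N ->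
  exists F : params N -> 'I_7 -> int,
    (forall p, coprime_params p -> (x%:Z %| quad k (F p))%Z) /\
    (forall p q, coprime_params p -> coprime_params q ->
      (forall i, (x%:Z %| F p i - F q i)%Z) -> p = q).
Proof.
move=> x_odd Nx; have [a' [b' /dvdnP[c' abx]]] := minus_one_two_squares x_odd.
pose a : int := a'; pose b : int := b'; pose c : int := c'.
have {}abx : a ^+ 2 + b ^+ 2 + 1 = c * x%:Z by rewrite /a /b /c; lia.
clearbody a b c; clear a' b' c'.
pose n1 (ij : 'I_N * 'I_N) : int := ij.1.+1.
pose n2 (ij : 'I_N * 'I_N) : int := ij.2.+1.
pose A ij : int := 2 * (a * n1 ij + b * n2 ij).
pose B ij : int := 2 * (a * n2 ij - b * n1 ij).
pose T ij (u : 'I_N * 'I_N * 'I_N) : int := 1 - k ^+ 2 - n1 ij ^+ 2 - n2 ij ^+ 2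
  - (u.1.1%:Z ^+ 2 + k * u.1.1%:Z) - (u.1.2%:Z ^+ 2 + k * u.1.2%:Z)
  - (u.2%:Z ^+ 2 + k * u.2%:Z).
have bez (ij : 'I_N * 'I_N) : coprime ij.1.+1 ij.2.+1 -> exists l1 l2 : int,
    l1 * A ij + l2 * B ij = 2 * (c * x%:Z - 1).
  move=> /bezout_int -/(_ isT) [c1 [c2 c12]].
  exists (c1 * a + c2 * b), (c2 * a - c1 * b).
  by rewrite -(bezout_combination c12 abx) /A /B /n1 /n2; ring.
have solve (iju : 'I_N * 'I_N * ('I_N * 'I_N * 'I_N)) :
    exists sr : int * int, coprime iju.1.1.+1 iju.1.2.+1 ->
    (x%:Z %| A iju.1 * sr.1 + B iju.1 * sr.2 - T iju.1 iju.2)%Z.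
  have [/bez[l1 [l2 l12]]|] := boolP (coprime iju.1.1.+1 iju.1.2.+1);
    last by exists (0, 0).
  (* h is the inverse of 2 modulo x. *)
  move: (T _ _) => t; pose h : int := x./2.+1.
  have h2 : 2 * h = 1 + x%:Z by rewrite /h; have := odd_double_half x; rewrite x_odd; lia.
  exists (- (h * t * l1), - (h * t * l2)) => _ /=.
  apply: (@dvdz_witness _ _ (t - t * c - t * c * x%:Z)).
  transitivity (- (h * t) * (l1 * A iju.1 + l2 * B iju.1) - t); first by ring.
  rewrite l12; transitivity (- (2 * h) * t * (c * x%:Z - 1) - t); first by ring.
  by rewrite h2; ring.
have [g gP] := choice solve; clear solve.
pose s (p : params N) := (g p.1).1 + B p.1.1 * (p.2 : nat)%:Z.
pose r (p : params N) := (g p.1).2 - A p.1.1 * (p.2 : nat)%:Z.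
pose F (p : params N) (i : 'I_7) := [:: n1 p.1.1 + s p * a - r p * b;
   n2 p.1.1 + s p * b + r p * a; s p; r p;
   (p.1.2.1.1 : nat)%:Z; (p.1.2.1.2 : nat)%:Z; (p.1.2.2 : nat)%:Z]`_i.
exists F; split=> [p cp|p q cp cq pq].
  have /dvdzP[w wE] := gP p.1 cp.
  rewrite /F quad_seq; apply: (@dvdz_witness _ _ (w + (s p ^+ 2 + r p ^+ 2) * c)).
  transitivity (w * x%:Z + (s p ^+ 2 + r p ^+ 2) * (c * x%:Z)); last by ring.
  by rewrite -wE -abx /T /s /r /A /B; ring.
have {}pq j : (j < 7)%N -> (x%:Z %| F p (inord j) - F q (inord j))%Z by move=> _.
have := (pq 0%N isT, pq 1%N isT, pq 2%N isT, pq 3%N isT).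
rewrite /F !inordK //= => -[[[d0 d1] d2] d3].
have := (pq 4%N isT, pq 5%N isT, pq 6%N isT).
rewrite /F !inordK //= => -[[d4 d5] d6].
have lt (i : 'I_N) : (i < x)%N by exact: leq_trans (ltn_ord i) (ltnW Nx).
have ltS (i : 'I_N) : (i.+1 < x)%N by exact: leq_ltn_trans (ltn_ord i) Nx.
have e4 := val_inj (dvdz_small_eq (lt _) (lt _) d4).
have e5 := val_inj (dvdz_small_eq (lt _) (lt _) d5).
have e6 := val_inj (dvdz_small_eq (lt _) (lt _) d6).
have dn1 : (x%:Z %| n1 p.1.1 - n1 q.1.1)%Z.
  rewrite (_ : _ - _ = (n1 p.1.1 + s p * a - r p * b - (n1 q.1.1 + s q * a - r q * b))
    - (s p - s q) * a + (r p - r q) * b); last by ring.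
  exact: rpredD (rpredB d0 (dvdz_mulr _ d2)) (dvdz_mulr _ d3).
have dn2 : (x%:Z %| n2 p.1.1 - n2 q.1.1)%Z.
  rewrite (_ : _ - _ = (n2 p.1.1 + s p * b + r p * a - (n2 q.1.1 + s q * b + r q * a))
    - (s p - s q) * b - (r p - r q) * a); last by ring.
  exact: rpredB (rpredB d1 (dvdz_mulr _ d2)) (dvdz_mulr _ d3).
have e0 : p.1.1.1 = q.1.1.1.
  by apply: val_inj; have := dvdz_small_eq (ltS _) (ltS _) dn1 => -[].
have e1 : p.1.1.2 = q.1.1.2.
  by apply: val_inj; have := dvdz_small_eq (ltS _) (ltS _) dn2 => -[].
have e : p.1 = q.1.
  move: e0 e1 e4 e5 e6.
  case: (p.1) (q.1) => [[i j] [[u v] z]] [[i' j'] [[u' v'] z']] /=.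
  by move=> -> -> -> -> ->.
have {}d2 : (x%:Z %| B p.1.1 * ((p.2 : nat)%:Z - (q.2 : nat)%:Z))%Z.
  by move: d2; rewrite /s -e; apply: etrans; congr (_ %| _)%Z; ring.
have {}d3 : (x%:Z %| A p.1.1 * ((p.2 : nat)%:Z - (q.2 : nat)%:Z))%Z.
  by rewrite -rpredN; move: d3; rewrite /r -e; apply: etrans; congr (_ %| _)%Z; ring.
have [l1 [l2 l12]] := bez _ cp.
have : (x%:Z %| (p.2 : nat)%:Z - (q.2 : nat)%:Z)%Z.
  apply: odd_dvdz2 => //.
  set z : int := _ - _ in d2 d3 *.
  rewrite (_ : 2 * z = 2 * c * z * x%:Z - l1 * (A p.1.1 * z) - l2 * (B p.1.1 * z)).
    exact: rpredB (rpredB (dvdz_mull _ (dvdzz _)) (dvdz_mull _ d3)) (dvdz_mull _ d2).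
  transitivity ((2 * (c * x%:Z) - (l1 * A p.1.1 + l2 * B p.1.1)) * z).
    by rewrite l12; ring.
  by ring.
move/(dvdz_small_eq (lt _) (lt _)) => /val_inj.
by move: e; case: (p) (q) => [p1 p2] [q1 q2] /= -> ->.
Qed.

(** * Orbits met by the family *)

Lemma fibre_representative (I : finType) (T : Type) (f : I -> T) :
  exists rep : I -> I, (forall i, f (rep i) = f i) /\
    (forall i j, f i = f j -> rep i = rep j).
Proof.
pose rep i := odflt i [pick j | `[< f j = f i >]].
exists rep; split=> [i|i j ij]; rewrite /rep.
  by case: pickP => [j /asboolP //|/(_ i)]; rewrite asboolT.
rewrite ij; case: pickP => // /(_ j); by rewrite asboolT.
Qed.

Lemma weyl_orbit_pair a b b' :
  weyl_orbit [set a; b]%classic = weyl_orbit [set a; b']%classic ->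
  exists2 w, weyl w & (w a = a /\ w b = b') \/ (w a = b' /\ w b = a).
Proof.
move=> ab; have : weyl_orbit [set a; b']%classic [set a; b']%classic.
  by exists id; [exact: weyl_id|rewrite image_id].
rewrite -ab => -[w hw wab]; exists w => //.
have wa : [set a; b']%classic (w a) by rewrite -wab; exists a => //; left.
have wb : [set a; b']%classic (w b) by rewrite -wab; exists b => //; right.
have [u ua au] : (w @` [set a; b])%classic a by rewrite wab; left.
have [v vb bv] : (w @` [set a; b])%classic b' by rewrite wab; right.
case: wa => wa; case: wb => wb; [left|by left|by right|right].
  by split=> //; case: vb bv => ->; rewrite ?wa ?wb.
by split=> //; case: ua au => ->; rewrite ?wa ?wb.
Qed.

Definition ordered_orbit (a b : e10_lattice) : set (e10_lattice * e10_lattice) :=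
  [set p | exists2 w, weyl w & p = (w a, w b)]%classic.

Lemma ordered_orbitP a b b' :
  ordered_orbit a b = ordered_orbit a b' <->
  exists2 w, weyl w & w a = a /\ w b = b'.
Proof.
split=> [ab|[w hw [wa wb]]].
  have : ordered_orbit a b' (a, b') by exists id => //; exact: weyl_id.
  by rewrite -ab => -[w hw [aw bw]]; exists w.
have [v [hv wK vK]] := weyl_has_inverse hw.
apply/seteqP; split=> p [u hu ->].
  exists (u \o v); first exact: weyl_comp.
  by rewrite /= -wb -{2}wa !wK.
by exists (u \o w); [exact: weyl_comp|rewrite /= wa wb].
Qed.

(** Records, for w fixing [delta], the products of the seven roots w r with the
    simple roots; those with the simple roots other than the one of index 8
    lie in [-2, 2]. *)
Definition product_table : finType := {ffun 'I_7 * 'I_10 -> 'I_5}.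

Lemma delta_fixed_bound w r (j : 'I_10) : weyl w -> w delta = delta ->
  inner r r = 2 -> inner r delta = 0 -> j != 8 :> nat ->
  -2 <= inner (w r) (simple_root j) <= 2.
Proof.
move=> hw wd r2 rd j8; apply: delta_perp_norm2_bound.
- by rewrite -{1}wd weyl_inner.
- by rewrite inner_delta simple_coord eq_sym -val_eqE /= inordK // (negPf j8) oppr0.
- by rewrite weyl_inner.
- exact: inner_simple_self.
Qed.

(** Within an unordered orbit there are at most two ordered ones, told apart by
    [same].  Within an ordered orbit each member is carried to a common
    representative by some w, which fixes [delta]; the table of products of
    the vectors w r then determines the member.  So the representative, the
    bit and the table together encode the index. *)
Lemma orbit_transversal (I : finType) (k : int) (a : e10_lattice)
    (b : I -> e10_lattice) (x : I -> int) (r : 'I_7 -> e10_lattice) :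
  inner a a = 2 -> (forall i, inner (b i) (b i) = 2) ->
  (forall i, inner a (b i) = k) -> inner a delta = 0 ->
  (forall i, inner (b i) delta = x i) -> (forall i, 0 < x i) ->
  (forall i j, 4 * (x i * x j) < k ^+ 2 - 4) ->
  (forall l, inner (r l) (r l) = 2) -> (forall l, inner (r l) delta = 0) ->
  (forall i j, x i = x j ->
     (forall l, exists c, inner (b i) (r l) - inner (b j) (r l) = c * x j) ->
     i = j) ->
  exists2 J : {set I},
    (#|I| <= #|J| * (2 * #|product_table|))%N &
    {in J &, injective (fun i => weyl_orbit [set a; b i]%classic)}.
Proof.
move=> a2 b2 ab ad bd x_gt0 x_small r2 rd b_inj.
pose orb i := weyl_orbit [set a; b i]%classic.
have [rep [repE rep_eq]] := fibre_representative orb.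
have [rep1 [rep1E rep1_eq]] := fibre_representative (fun i => ordered_orbit a (b i)).
have /choice[W W_P] i : exists w, [/\ weyl w, w a = a & w (b i) = b (rep1 i)].
  by have /ordered_orbitP[w hw [wa wb]] := esym (rep1E i); exists w.
have Wd i : W i delta = delta /\ x i = x (rep1 i).
  have [hw wa wb] := W_P i.
  exact: (small_null_unique hw wa wb a2 (b2 i) (ab i) ad (bd i) (bd _)).
(* Adding 2 makes the products natural numbers below 5, except those with the
   simple root of index 8, whose entries carry no meaning. *)
pose type i : product_table := [ffun lj : 'I_7 * 'I_10 =>
  inord (absz (inner (W i (r lj.1)) (simple_root lj.2) + 2))].
pose same i := `[< ordered_orbit a (b i) = ordered_orbit a (b (rep i)) >].
pose code i := (rep i, (same i, type i)).
have code_inj : injective code.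
  move=> i j [rij sij tij].
  have oij : ordered_orbit a (b i) = ordered_orbit a (b j).
    move: sij; rewrite /same; have [si|si] := asboolP; have [sj|sj] := asboolP => // _.
      by rewrite si rij -sj.
    (* Both are matched crosswise with the representative: compose. *)
    have [w hw [wab|[wa wb]]] := weyl_orbit_pair (esym (repE i)).
      by case: si; apply/ordered_orbitP; exists w.
    have [w' hw' [wab|[wa' wb']]] := weyl_orbit_pair (esym (repE j)).
      by case: sj; apply/ordered_orbitP; exists w'.
    have [v [hv wK vK]] := weyl_has_inverse hw'.
    apply/ordered_orbitP; exists (v \o w); first exact: weyl_comp.
    by rewrite /= wa wb rij -{1}wa' -wb' !wK.
  have r1 := rep1_eq _ _ oij.
  have [[hi ia ib] [hj ja jb]] := (W_P i, W_P j).
  have [[id xi] [jd xj]] := (Wd i, Wd j).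
  have xx : x i = x j by rewrite xi xj r1.
  apply: b_inj => // l.
  have jb' : W j (b j) = b (rep1 i) by rewrite r1.
  have td : inner (b (rep1 i)) delta = x j by rewrite bd -xi.
  apply: (same_type_congr hi hj id jd ib jb' td (rd l)) => s s8.
  have := congr1 (fun t : product_table => (t (l, s) : nat)) tij.
  rewrite !ffunE /=.
  have := (delta_fixed_bound hi id (r2 l) (rd l) s8,
           delta_fixed_bound hj jd (r2 l) (rd l) s8) => -[bi bj].
  rewrite !inordK; lia.
exists [set rep i | i in I].
  have -> : (2 * #|product_table|)%N = #|{: bool * product_table}| by rewrite card_prod card_bool.
  rewrite -[X in (_ * X)%N]cardsT -cardsX -(card_imset _ code_inj).
  apply: subset_leq_card; apply/fintype.subsetP => _ /imsetP[i _ ->].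
  by rewrite inE /= inE andbT; apply: imset_f.
move=> _ _ /imsetP[i _ ->] /imsetP[j _ ->] ij; apply: rep_eq.
by rewrite -repE -[RHS]repE.
Qed.

Lemma counting_ge (R : realType) (T : choiceType) (I : finType) (J : {set I})
    (f : I -> T) (A : set T) :
  {in J &, injective f} -> (forall i, i \in J -> A (f i)) ->
  ((#|J|%:R : R)%:E <= counting A)%E.
Proof.
move=> f_inj fA; rewrite /counting; case: asboolP => [finA|_]; last exact: leey.
rewrite lee_fin ler_nat.
have -> : #|J| = #|` [fset f i | i in J]%fset |.
  by rewrite card_in_imfset //= -cardE.
apply: fsubset_leq_card; apply/fsubsetP => _ /imfsetP[i /= iJ ->].
by rewrite in_fset_set //; apply/mem_set/fA.
Qed.

Lemma prenilpotent_orbit k a b : 0 < k -> inner a a = 2 -> inner b b = 2 ->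
  inner a b = k ->
  [set weyl_orbit P | P in prenilpotent_pairs k]%classic
    (weyl_orbit [set a; b]%classic).
Proof.
move=> k0 a2 b2 ab; exists [set a; b]%classic => //; exists a, b; split=> //.
by apply: prenilpotent_norm2; rewrite // ab.
Qed.

(** * Counting the orbits *)

Definition family_params (n : nat) : {set 'I_n * params (2 * n)} :=
  [set p | coprime_params p.2].

Lemma card_family_params n : (16 * n ^ 7 <= #|family_params n|)%N.
Proof.
pose C : {set 'I_(2 * n) * 'I_(2 * n)} := [set ij : 'I_(2 * n) * 'I_(2 * n) | coprime ij.1.+1 ij.2.+1].
have C_ge : (n ^ 2 <= #|C|)%N.
  have := coprime_pairs_count (2 * n).
  suff -> : (\sum_(i < 2 * n) \sum_(j < 2 * n) coprime i.+1 j.+1 = #|C|)%N.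
    by rewrite expnMn; lia.
  rewrite pair_bigA /= -sum1_card [RHS]big_mkcond /=.
  by apply: eq_bigr => ij _; rewrite inE; case: coprime.
suff -> : family_params n = finset.setX [set: 'I_n] (finset.setX (finset.setX C [set: _]) [set: _]).
  rewrite !cardsX !cardsT !card_prod !card_ord.
  apply: (@leq_trans (n * (n ^ 2 * (2 * n * (2 * n) * (2 * n)) * (2 * n)))%N).
    by rewrite leq_eqVlt; apply/orP; left; apply/eqP; ring.
  by rewrite leq_mul2l !leq_mul2r C_ge !orbT.
apply/finset.setP => -[j [[ij u] t]]; rewrite !inE /= !andbT; exact: erefl.
Qed.

(** The odd values x = 2n + 2j + 1 with j < n exceed 2n, so that parameters
    below 2n are distinct modulo x, and stay below 4n <= k/4, so that
    4 x x' < k^2 - 4. *)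
Lemma orbits_ge (R : realType) (n k : nat) : (0 < n)%N -> (16 * n <= k)%N ->
  ((16 * n%:R ^+ 7 / (2 * #|product_table|)%N%:R : R)%:E <= num_orbits R k%:Z)%E.
Proof.
move=> n0 nk; pose N := (2 * n)%N.
pose X (j : 'I_n) : nat := (N + j.*2.+1)%N.
have X_odd j : odd (X j) by rewrite /X /N oddD oddM /= odd_double.
have X_gt j : (N < X j)%N by rewrite /X; lia.
have X_le j : (X j <= 4 * n)%N by rewrite /X /N; have := ltn_ord j; lia.
have /choice[F F_P] j := quad_zeros k (X_odd j) (X_gt j).
pose I : finType := {p | p \in family_params n}.
pose y (p : 'I_n * params N) := - (quad k (F p.1 p.2) %/ (X p.1)%:Z)%Z.
pose b (i : I) := partner k (X (val i).1) (y (val i)) (F (val i).1 (val i).2).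
have cop (i : I) : coprime_params (val i).2 by have := valP i; rewrite inE.
have [[a2 _ _ ad _] _] := gram.
have b2 i : inner (b i) (b i) = 2.
  rewrite /b partner_norm; have [dvd _] := F_P (val i).1.
  have := divzK (dvd _ (cop i)); rewrite /y mulrN mulrC => ->.
  by rewrite /quad; ring.
have ab i : inner fixed_root (b i) = k by rewrite innerC partner_fixed_root.
have bd i : inner (b i) delta = (X (val i).1)%:Z by rewrite partner_delta.
have x0 (i : I) : 0 < (X (val i).1)%:Z :> int.
  by rewrite ltz_nat (leq_ltn_trans _ (X_gt _)).
have xs (i j : I) : 4 * ((X (val i).1)%:Z * (X (val j).1)%:Z) < k%:Z ^+ 2 - 4 :> int.
  have := (X_le (val i).1, X_le (val j).1); move: (X _) (X _) => u v [hu hv].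
  have uv : (u * v <= 4 * n * (4 * n))%N by exact: leq_mul.
  have kk : (16 * n * (16 * n) <= k * k)%N by exact: leq_mul.
  have nn : (n <= n * n)%N by rewrite leq_pmulr.
  rewrite expr2; lia.
have r2 (l : 'I_7) : inner (orth_root l) (orth_root l) = 2.
  by rewrite orth_root_orth eqxx mulr1.
have rd (l : 'I_7) : inner (orth_root l) delta = 0.
  by have [_ _ ->] := orth_root_perp l.
have b_inj (i j : I) : (X (val i).1)%:Z = (X (val j).1)%:Z :> int ->
   (forall l : 'I_7, exists c, inner (b i) (orth_root l) - inner (b j) (orth_root l)
     = c * (X (val j).1)%:Z) -> i = j.
  move=> [Xij] h.
  have ij : (val i).1 = (val j).1.
    by apply: val_inj => /=; move: Xij; rewrite /X; lia.
  apply: val_inj; move: ij h; rewrite /b.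
  have := (cop i, cop j); case: (val i) (val j) => [ji p] [jj q] /= [cp cq] ij h.
  subst jj; congr (_, _); have [_ inj] := F_P ji; apply: inj => // l.
  have [c cE] := h l; apply: odd_dvdz2 => //.
  apply: (@dvdz_witness _ _ c); rewrite -cE !partner_orth; ring.
have [J J_card J_inj] := orbit_transversal a2 b2 ab ad bd x0 xs r2 rd b_inj.
apply: le_trans (counting_ge R J_inj _); last first.
  move=> i _; apply: prenilpotent_orbit => //.
  by rewrite ltz_nat (leq_trans _ nk) // muln_gt0.
have M0 : (0 < 2 * #|product_table|)%N.
  by rewrite muln_gt0 /=; apply/card_gt0P; exists [ffun => ord0].
rewrite lee_fin ler_pdivrMr ?ltr0n // -natrM -natrX -natrM ler_nat.
apply: leq_trans J_card; rewrite card_sig; exact: card_family_params.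
Qed.

(** The member of the family with x = 1 and v = k [glue] exists for all k. *)
Lemma orbits_ge1 (R : realType) (k : nat) : (0 < k)%N ->
  (1%:E <= num_orbits R k%:Z)%E.
Proof.
move=> k0; have [[a2 _ _ _ _] _] := gram.
pose b := partner k 1 (1 - k%:Z ^+ 2) (fun=> 0).
have b2 : inner b b = 2.
  by rewrite partner_norm big1 => [|i _]; rewrite ?expr0n ?mul0r ?mulr0 ?addr0 //; ring.
have ab : inner fixed_root b = k by rewrite innerC partner_fixed_root.
pose f (_ : unit) := weyl_orbit [set fixed_root; b]%classic.
have f_inj : {in [set: unit] &, injective f} by move=> [] [].
have fA i : i \in [set: unit] ->
    [set weyl_orbit P | P in prenilpotent_pairs k]%classic (f i).
  by move=> _; exact: prenilpotent_orbit.
by have := counting_ge R f_inj fA; rewrite cardsT card_unit.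
Qed.

Theorem theorem1 (R : realType) :
  exists C : R, 0 < C /\
    forall k : int, ((C * (k%:~R ^+ 7))%:E <= num_orbits R k)%E.
Proof.
set M : R := (2 * #|product_table|)%N%:R.
have M1 : 1 <= M.
  by rewrite /M ler1n muln_gt0 /=; apply/card_gt0P; exists [ffun => ord0].
have M0 : 0 < M by exact: lt_le_trans M1.
have c0 : 0 < 32 ^+ 7 * M by rewrite mulr_gt0 // exprn_gt0.
exists (32 ^+ 7 * M)^-1; rewrite invr_gt0; split=> // k.
have [k_le0|k_gt0] := lerP k 0.
  apply: (@le_trans _ _ 0%E); last first.
    by rewrite /num_orbits /counting; case: ifP => _; rewrite ?lee_fin ?leey.
  by rewrite lee_fin mulr_ge0_le0 ?invr_ge0 ?exprn_odd_le0 ?lerz0 // ltW.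
case: k k_gt0 => // k; rewrite ltz_nat -pmulrn => k0.
(* For n >= 1 this gives 16 n <= k < 32 n; for n = 0 one orbit suffices. *)
pose n := (k %/ 16)%N.
have k_lt : (k < 16 * n.+1)%N by rewrite mulnC ltn_ceil.
have [n0|n0] := posnP n.
  apply: le_trans (orbits_ge1 R k0).
  rewrite lee_fin mulrC ler_pdivrMr // mul1r.
  rewrite -[leLHS]mulr1 ler_pM ?exprn_ge0 //.
  by rewrite lerXn2r ?nnegrE ?ler_nat //; move: k_lt; rewrite n0; lia.
have nk : (16 * n <= k)%N by rewrite mulnC leq_trunc_div.
apply: le_trans (orbits_ge R n0 nk); rewrite -/M lee_fin.
have kn : (k%:R : R) ^+ 7 <= 32 ^+ 7 * n%:R ^+ 7.
  rewrite -exprMn lerXn2r ?nnegrE ?mulr_ge0 // -natrM ler_nat; lia.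
rewrite mulrC ler_pdivrMr //.
have -> : 16 * n%:R ^+ 7 / M * (32 ^+ 7 * M) = 16 * (32 ^+ 7 * n%:R ^+ 7).
  by move: (n%:R ^+ 7) => t; clearbody M; field; rewrite gt_eqF.
apply: le_trans kn _; rewrite ler_peMl ?mulr_ge0 ?exprn_ge0 //.
by rewrite ler1n.
Qed.
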